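(* Let $X$ be a Hausdorff topological vector space over $\mathbb{R}$ or $\mathbb{C}$, $A\subset X$ a convex set, $H$ a nonempty set of functions $X\to\overline{\mathbb{R}}$ closed under vertical shifts (i.e. $h+c\in H$ for all $h\in H$, $c\in\mathbb{R}$), and $f_0\colon X\to\mathbb{R}$. Let $\{\varphi_\lambda\}$, $\lambda\in\Lambda$, be an exhaustive family of weak upper $H$-convex approximations of $f_0$ at a point $x^*\in A$, and let $x^*$ be a point of local maximum of $f_0$ on $A$. Suppose that for any $g\in\Gamma(x^*,A)$ there exists $\alpha_g>0$ such that for any $\lambda\in\Lambda$ the function $\alpha\mapsto\varphi_\lambda(\alpha g)$, $\alpha\in[0,\alpha_g)$, is convex. Then for any $\varepsilon>0$ and $g\in\gamma(x^*,A)$ there exists $\lambda\in\Lambda$ such that $$\varphi'_\lambda(0,g)\le\varepsilon,$$ where $\varphi'_\lambda(0,g)$ is the directional derivative of $\varphi_\lambda$ at the origin in the direction $g$. Moreover, if $\Lambda$ is finite, then for any $g\in\gamma(x^*,A)$ there exists $\lambda\in\Lambda$ such that $\varphi'_\lambda(0,g)\le0$. If, in addition, for any $\lambda\in\Lambda$ the function $\varphi'_\lambda(0,\cdot)$ is continuous on $\Gamma(x^*,A)$, then for any $g\in\Gamma(x^*,A)$ there exists $\lambda\in\Lambda$ such that $\varphi'_\lambda(0,g)\le0$.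
   Context: $\overline{\mathbb{R}}=\mathbb{R}\cup\{\pm\infty\}$; for $f\colon X\to\overline{\mathbb{R}}$, $\operatorname{dom}f=\{x: f(x)\in\mathbb{R}\}$. A function $X\to\overline{\mathbb{R}}$ is $H$-convex if it is the pointwise supremum of a nonempty subset of $H$. $\gamma(x,A)=\{g\in X\mid\exists\alpha>0:\ x+\alpha g\in A\}$ and $\Gamma(x,A)=\operatorname{cl}\gamma(x,A)$. An $H$-convex function $\varphi\colon X\to\overline{\mathbb{R}}$ is a weak upper $H$-convex approximation of $f\colon X\to\mathbb{R}$ at $x$ if (1) $\varphi(0)\ge0$ and $0\in\operatorname{int}\operatorname{dom}\varphi$; (2) for every $\Delta x\in X$ there exist $\alpha_0>0$ and $\beta\colon(0,\alpha_0)\to\mathbb{R}$ such that $\operatorname{co}\{0,\alpha_0\Delta x\}\subset\operatorname{dom}\varphi$, $\beta(\alpha)\to0$ as $\alpha\downarrow0$, and $f(x+\alpha\Delta x)-f(x)\le\varphi(\alpha\Delta x)+\alpha\beta(\alpha)$ for all $\alpha\in(0,\alpha_0)$. A family $\{\varphi_\lambda\}_{\lambda\in\Lambda}$ of weak upper $H$-convex approximations of $f$ at $x$ is exhaustive if $\inf_{\lambda\in\Lambda}\varphi_\lambda(0)=0$ and $f(x+\Delta x)-f(x)=\inf_{\lambda\in\Lambda}\varphi_\lambda(\Delta x)+o(\Delta x,x)$, where for every $\Delta x\in X$ one has $o(\alpha\Delta x,x)/\alpha\to0$ as $\alpha\downarrow0$. The directional derivative is $\varphi'_\lambda(0,g)=\lim_{\alpha\downarrow0}(\varphi_\lambda(\alpha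 g)-\varphi_\lambda(0))/\alpha$. *)

(* Defs.v *)
From HB Require Import structures.
From mathcomp Require Import all_boot all_order all_algebra.
From mathcomp Require Export complex.
From mathcomp Require Export all_classical all_reals all_analysis.
Set Implicit Arguments.
Unset Strict Implicit.
Unset Printing Implicit Defensive.
Import Order.TTheory GRing.Theory Num.Theory.
Import numFieldNormedType.Exports.

Local Open Scope classical_set_scope.
Local Open Scope ring_scope.
Local Open Scope complex_scope.
Local Open Scope ereal_scope.

Reserved Notation "t *:r x" (at level 40).

Variant scalar_kind := real_scalars | complex_scalars.

Definition scalars (R : realType) (k : scalar_kind) : numFieldType :=
  match k with
  | real_scalars => R : numFieldType
  | complex_scalars => R[i] : numFieldType
  end.

Definition real_scalar (R : realType) (k : scalar_kind) : R -> scalars R k :=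
  match k return R -> scalars R k with
  | real_scalars => fun t => t
  | complex_scalars => fun t => t%:C
  end.

Section Definitions.
(* [topologicalLmodType] is a topological vector space that is not assumed
   Hausdorff nor locally convex (unlike [tvsType], which is locally convex). *)
Context {R : realType} {k : scalar_kind} {X : topologicalLmodType (scalars R k)}.
Implicit Types (t a : R) (x g dx : X) (A : set X) (H : set (X -> \bar R)).
Implicit Types (f : X -> R) (phi : X -> \bar R).

Definition rscale t x : X := real_scalar k t *: x.
Local Notation "t *:r x" := (rscale t x).

(* [convex_set] quantifies over weights [l] in K with 0 <= l <= 1; for K = R[i]
   this order forces l to be real, so this is real convexity for both K. *)
Definition convex_hull A : set X :=
  \bigcap_(C in [set C : set X | A `<=` C /\ @convex_set (scalars R k) X C]) C.

Definition feasible_dirs x A : set X :=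
  [set g | exists2 a, (0 < a)%R & A (x + a *:r g)%R].

Definition closed_feasible_dirs x A : set X := closure (feasible_dirs x A).

Definition edom phi : set X := [set x | phi x \is a fin_num].

Definition shift_closed H := forall h (c : R), H h -> H (fun x => h x + c%:E).

Definition H_convex H phi :=
  exists S : set (X -> \bar R),
    [/\ S `<=` H, S !=set0 & forall x, phi x = ereal_sup [set h x | h in S]].

Definition weak_upper_approx H f x phi :=
  [/\ H_convex H phi, 0 <= phi 0%R, (edom phi)° 0%R &
      forall dx, exists (a0 : R) (beta : R -> R),
        [/\ (0 < a0)%R,
            convex_hull [set 0%R; a0 *:r dx] `<=` edom phi,
            beta a @[a --> 0%R^'+] --> (0%R : R) &
            forall a, (0 < a < a0)%R ->
              (f (x + a *:r dx)%R - f x)%:E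
                <= phi (a *:r dx) + (a * beta a)%:E]].

Definition exhaustive (Lambda : Type) H f x (phi : Lambda -> X -> \bar R) :=
  [/\ forall l, weak_upper_approx H f x (phi l),
      ereal_inf (range (fun l => phi l 0%R)) = 0 &
      exists o : X -> R,
        (forall dx, (f (x + dx)%R - f x)%:E
                    = ereal_inf (range (fun l => phi l dx)) + (o dx)%:E) /\
        (forall dx, (o (a *:r dx) / a)%R @[a --> 0%R^'+] --> (0%R : R))].

Definition local_max_on A f x := \forall y \near x, A y -> (f y <= f x)%R.

(* Convexity on [0, b[ of an extended real-valued function: its epigraph is
   convex, so that no sum (+oo) + (-oo) has to be given a value. *)
Definition convex_on_co (b : R) (u : R -> \bar R) :=
  @convex_set R (R^o * R^o)%type
    [set p : R * R | (0 <= p.1 < b)%R /\ u p.1 <= (p.2)%:E].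

Definition diff_quotient phi x g : R -> \bar R :=
  fun a => (phi (x + a *:r g)%R - phi x) * (a^-1)%:E.

Definition dir_derivable phi x g := cvg (diff_quotient phi x g a @[a --> 0%R^'+]).

(* The limit is taken in the extended reals, so -oo is an admissible value. *)
Definition dir_deriv phi x g : \bar R :=
  lim (diff_quotient phi x g a @[a --> 0%R^'+]).

End Definitions.

Notation "t *:r x" := (rscale t x) : ring_scope.

(* Main.v *)
(* If x + t g is feasible for small t > 0, local maximality and exhaustiveness
   give inf_l phi_l (t g) <= o(t), so at some t below alpha_g one single l
   satisfies phi_l (t g) < eps t.  Since phi_l 0 >= 0, the difference quotient of
   phi_l at t is at most eps, and by convexity along the ray it dominates the
   directional derivative.  When Lambda is finite, failure of the conclusion at g
   means that finitely many derivatives are positive; this persists with a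
   uniform eps, and, by continuity, at some feasible direction near g. *)
Require Import Defs.
From mathcomp Require Import all_boot all_order all_algebra.
From mathcomp Require Import all_classical all_reals all_analysis.
From mathcomp Require Import unstable lra.
Set Implicit Arguments.
Unset Strict Implicit.
Unset Printing Implicit Defensive.
Import Order.TTheory GRing.Theory Num.Theory.
Import numFieldNormedType.Exports.
Local Open Scope classical_set_scope.
Local Open Scope ring_scope.

(** * Real scalars inside the field of scalars *)

Lemma real_scalarM (R : realType) (k : scalar_kind) :
  {morph @real_scalar R k : s t / s * t}.
Proof. by case: k => s t //=; rewrite rmorphM. Qed.

Lemma real_scalar0 (R : realType) (k : scalar_kind) : real_scalar k (0 : R) = 0.
Proof. by case: k. Qed.

Lemma real_scalar1 (R : realType) (k : scalar_kind) : real_scalar k (1 : R) = 1.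
Proof. by case: k. Qed.

Lemma ler_real_scalar (R : realType) (k : scalar_kind) :
  {mono @real_scalar R k : s t / s <= t}.
Proof. by case: k => s t //=; rewrite lecR. Qed.

Lemma real_scalar_cvg0 (R : realType) (k : scalar_kind) :
  real_scalar k t @[t --> (0 : R)^'+] --> (0 : (scalars R k)^o).
Proof.
apply/cvgrPdist_le => e; case: k e => /= e e0.
  near=> t; rewrite sub0r normrN ger0_norm; near: t; first exact: nbhs_right_le.
  exact: nbhs_right_ge.
(* A positive element of [R[i]] is real, so the estimate reduces to one in [R]. *)
have eR : e = (complex.Re e)%:C%C by rewrite (RRe_real (gtr0_real e0)).
near=> t; rewrite sub0r normrN ger0_norm ?lecR; last first.
  by near: t; exact: nbhs_right_ge.
rewrite eR lecR; near: t; apply: nbhs_right_le.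
by move: e0; rewrite {1}eR ltcR.
Unshelve. all: end_near. Qed.

(** * Rays and feasible directions *)

Section RScale.
Context {R : realType} {k : scalar_kind} {X : topologicalLmodType (scalars R k)}.
Implicit Types (s t : R) (x g : X).

Lemma rscale0 x : 0 *:r x = 0.
Proof. by rewrite /rscale real_scalar0 scale0r. Qed.

Lemma rscale_cvg0 g : t *:r g @[t --> (0 : R)^'+] --> (0 : X).
Proof.
rewrite -(scale0r g); apply: (cvg_comp2 (@real_scalar_cvg0 R k) (cvg_cst g)).
exact: (@scale_continuous _ X (0, g)).
Qed.

Lemma ray_cvg x g : x + t *:r g @[t --> (0 : R)^'+] --> x.
Proof.
rewrite -[X in _ --> X]addr0; apply: (cvg_comp2 (cvg_cst x) (rscale_cvg0 g)).
exact: (@add_continuous X (x, 0)).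
Qed.

(** The point is the convex combination of [x + a *:r g] and [x] with weight [t / a] on the
    former. *)
Lemma convex_ray (A : set X) x g (a t : R) :
  @convex_set (scalars R k) X A -> A x -> A (x + a *:r g) ->
  0 < a -> 0 <= t <= a -> A (x + t *:r g).
Proof.
move=> cA Ax Axa a0 /andP[t0 ta].
have p0 : 0 <= real_scalar k (t / a).
  by rewrite -(@real_scalar0 R k) ler_real_scalar divr_ge0// ltW.
have p1 : real_scalar k (t / a) <= 1.
  by rewrite -(@real_scalar1 R k) ler_real_scalar ler_pdivrMr// mul1r.
have := cA _ _ (Itv01 p0 p1) (mem_set Axa) (mem_set Ax).
move/set_mem; congr (A _); rewrite /conv/= scalerDr addrAC -scalerDl.
by rewrite add_onemK scale1r /rscale scalerA -real_scalarM divfK// gt_eqF.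
Qed.

Lemma feasible_dirs_near (A : set X) x g :
  @convex_set (scalars R k) X A -> A x -> feasible_dirs x A g ->
  \forall t \near (0 : R)^'+, A (x + t *:r g).
Proof.
move=> cA Ax [a a0 Axa]; near=> t.
apply: (convex_ray cA Ax Axa) => //; apply/andP; split; near: t.
  exact: nbhs_right_ge.
exact: nbhs_right_le.
Unshelve. all: end_near. Qed.

End RScale.

(** Weight [s / t] on the epigraph points [(t, y)] and [(0, c)] gives abscissa [s]. A real majorant
    [y] replaces [u t], so that the value -oo is also covered. *)
Lemma convex_on_co_chord (R : realType) (b : R) (u : R -> \bar R) (c s t y : R) :
  convex_on_co b u -> u 0 = c%:E -> 0 < s -> s <= t -> t < b ->
  (u t <= y%:E)%E -> (u s <= (c + s / t * (y - c))%:E)%E.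
Proof.
move=> cu u0 s0 st tb uty; have t0 : 0 < t by exact: lt_le_trans st.
have p0 : 0 <= s / t by rewrite divr_ge0// ltW.
have p1 : s / t <= 1 by rewrite ler_pdivrMr// mul1r.
pose epi := [set p : R * R | (0 <= p.1 < b) /\ (u p.1 <= p.2%:E)%E].
have h1 : ((t, y) : R * R) \in epi.
  by rewrite inE /epi/= (ltW t0) tb.
have h0 : ((0, c) : R * R) \in epi.
  by rewrite inE /epi/= lexx u0 (lt_trans t0 tb).
have := cu _ _ (Itv01 p0 p1) h1 h0.
rewrite inE => -[_]; rewrite /conv/= /GRing.scale/=.
rewrite mulr0 addr0 divfK ?gt_eqF// => h; apply: (le_trans h).
by rewrite lee_fin /onem; lra.
Qed.

(** * Monotone difference quotients along a ray *)

Section DiffQuotient.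
Context {R : realType} {k : scalar_kind} {X : topologicalLmodType (scalars R k)}.
Implicit Types (s t : R) (x g : X) (phi : X -> \bar R).

Lemma diff_quotient0_le phi g (c t z : R) : phi 0 = c%:E -> 0 < t ->
  (diff_quotient phi 0%R g t <= z%:E)%E = (phi (t *:r g) <= (c + t * z)%:E)%E.
Proof.
move=> phi0 t0; rewrite /diff_quotient add0r phi0 lee_pdivrMr//.
by rewrite leeBlDr// -EFinM -EFinD addrC mulrC.
Qed.

Lemma diff_quotient0_homo phi g (b : R) : phi 0 \is a fin_num ->
  convex_on_co b (fun t => phi (t *:r g)) ->
  {in `]0, b[ &, {homo diff_quotient phi 0%R g : s t / s <= t >-> (s <= t)%E}}.
Proof.
move=> /fineK/esym phi0 cphi s t.
rewrite !in_itv/= => /andP[s0 sb] /andP[t0 tb] st.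
(* Real upper bounds pass from [t] to [s]: the chord inequality with [y = c + t * z] gives the bound
   [c + s * z]. *)
have le_real (z : R) :
    (diff_quotient phi 0%R g t <= z%:E)%E ->
    (diff_quotient phi 0%R g s <= z%:E)%E.
  rewrite (diff_quotient0_le _ _ phi0)// (diff_quotient0_le _ _ phi0)// => h.
  have := convex_on_co_chord cphi _ s0 st tb h; rewrite rscale0 => /(_ _ phi0).
  by rewrite addrAC subrr add0r mulrA divfK// gt_eqF.
case: (diff_quotient phi 0%R g t) le_real => [r||] le_real.
- exact: le_real.
- exact: leey.
(* The quotient at [t] is -oo, so every real bounds the one at [s]: [r - 1] rules out a finite value
   [r], and 0 rules out +oo. *)
- case: (diff_quotient phi 0%R g s) le_real => [r||//] le_real.
    by have := le_real (r - 1) (leNye _); rewrite lee_fin lerBrDl gerDr ler10.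
  exact: le_real 0 (leNye _).
Qed.

Lemma dir_derivable0 phi g (b : R) : 0 < b -> phi 0 \is a fin_num ->
  convex_on_co b (fun t => phi (t *:r g)) -> dir_derivable phi 0 g.
Proof.
move=> b0 phi0 cphi; apply: nondecreasing_at_right_is_cvge; near=> e => s t.
rewrite !in_itv/= => /andP[s0 se] /andP[t0 te].
apply: (diff_quotient0_homo phi0 cphi); rewrite in_itv/= ?s0 ?t0 /=.
  by apply: (lt_trans se); near: e; exact: nbhs_right_lt.
by apply: (lt_trans te); near: e; exact: nbhs_right_lt.
Unshelve. all: end_near. Qed.

(** The quotients decrease to their limit as the step decreases to 0. *)
Lemma dir_deriv0_le phi g (b t : R) : phi 0 \is a fin_num ->
  convex_on_co b (fun t => phi (t *:r g)) -> 0 < t < b ->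
  (dir_deriv phi 0%R g <= diff_quotient phi 0%R g t)%E.
Proof.
move=> phi0 cphi /andP[t0 tb]; have b0 := lt_trans t0 tb.
apply: lime_le; first exact: (dir_derivable0 b0 phi0 cphi).
near=> s; have s0 : 0 < s by near: s; exact: nbhs_right_gt.
have st : s <= t by near: s; exact: nbhs_right_le.
apply: (diff_quotient0_homo phi0 cphi) => //.
  by rewrite in_itv/= s0 (le_lt_trans st tb).
by rewrite in_itv/= t0 tb.
Unshelve. all: end_near. Qed.

End DiffQuotient.

Lemma near_finite (T I : Type) (F : set_system T) (P : I -> T -> Prop) :
  Filter F -> finite_set [set: I] -> (forall i, \forall x \near F, P i x) ->
  \forall x \near F, forall i, P i x.
Proof.
move=> FF fI FP.
(* [I] carries no choice structure, so the finite intersection is indexed by the sets [P i]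
   themselves. *)
have finP : finite_set (range P) by exact: finite_image.
have h : F (\bigcap_(B in range P) B).
  rewrite -(fset_setK finP); apply: filter_bigI => B.
  by rewrite in_fset_set// => /set_mem[i _ <-]; exact: FP.
by apply: filterS h => x Px i; apply: (Px (P i)); exists i.
Qed.

(** * Local maximality and the exhaustive family *)

Section MaximumCondition.
Context {R : realType} {k : scalar_kind} {X : topologicalLmodType (scalars R k)}.
Context {A : set X} {H : set (X -> \bar R)} {f : X -> R} {x : X}.
Context {Lambda : Type} {phi : Lambda -> X -> \bar R}.
Context (cA : @convex_set (scalars R k) X A) (Ax : A x).
Context (ephi : exhaustive H f x phi) (fx : local_max_on A f x).

Lemma exhaustive_fin_num0 l : phi l 0 \is a fin_num.
Proof. by have [/(_ l)[_ _ /interior_subset]] := ephi. Qed.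

Lemma exhaustive_inf_near (eps : R) g : 0 < eps -> feasible_dirs x A g ->
  \forall t \near (0 : R)^'+, exists l, (phi l (t *:r g) < (eps * t)%:E)%E.
Proof.
move=> e0 xg; have [_ _ [rem [fE rem0]]] := ephi; near=> t.
have t0 : 0 < t by near: t; exact: nbhs_right_gt.
have ft : f (x + t *:r g) <= f x.
  have At : A (x + t *:r g) by near: t; exact: feasible_dirs_near.
  by move: At; near: t; exact: (@ray_cvg _ _ _ x g _ fx).
have ot : `|rem (t *:r g) / t| < eps.
  rewrite -normrN -[X in `|X|]add0r; near: t.
  by have /cvgrPdist_lt := rem0 g; apply.
have [_ [l _ <-] lt_l] : exists2 y, range (fun l => phi l (t *:r g)) y &
    (y < (eps * t)%:E)%E.
  apply: ereal_inf_lt.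
  (* The infimum cannot be +oo, since the increment of [f] is real. If it is a real [v], then
     [v <= - rem (t *:r g) < eps * t], because the increment is nonpositive. *)
  have := fE (t *:r g).
  case: (ereal_inf _) => [v|//|_]; last exact: ltNyr.
  rewrite -EFinD => -[fv]; rewrite lte_fin.
  move: ot; rewrite normrM normfV (gtr0_norm t0) ltr_pdivrMr//.
  by move=> /ltr_normlP[? _]; lra.
by exists l.
Unshelve. all: end_near. Qed.

Lemma dir_deriv_le_eps (eps b : R) g : 0 < eps -> 0 < b ->
  (forall l, convex_on_co b (fun t => phi l (t *:r g))) ->
  feasible_dirs x A g -> exists l, (dir_deriv (phi l) 0%R g <= eps%:E)%E.
Proof.
move=> e0 b0 cphi xg; near (0 : R)^'+ => t.
have [l lt_l] : exists l, (phi l (t *:r g) < (eps * t)%:E)%E.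
  by near: t; exact: exhaustive_inf_near.
have t0 : 0 < t by near: t; exact: nbhs_right_gt.
have t0b : 0 < t < b by rewrite t0; near: t; exact: nbhs_right_lt.
exists l; have fin0 := exhaustive_fin_num0 l.
apply: (le_trans (dir_deriv0_le fin0 (cphi l) t0b)).
have /fineK/esym phi0 := fin0.
(* Nonnegativity at the origin turns [phi l (t *:r g) < eps * t] into a bound [eps] on the quotient
   at [t]. *)
have c0 : 0 <= fine (phi l 0).
  by rewrite fine_ge0//; have [/(_ l)[]] := ephi.
rewrite (diff_quotient0_le _ _ phi0)//; apply: (le_trans (ltW lt_l)).
by rewrite lee_fin mulrC lerDr.
Unshelve. all: end_near. Qed.

End MaximumCondition.

Theorem theorem5p7 (R : realType) (k : scalar_kind)
    (X : topologicalLmodType (scalars R k)) (A : set X)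
    (H : set (X -> \bar R)) (f0 : X -> R) (xs : X)
    (Lambda : Type) (phi : Lambda -> X -> \bar R) :
  hausdorff_space X ->
  @convex_set (scalars R k) X A ->
  H !=set0 ->
  shift_closed H ->
  A xs ->
  exhaustive H f0 xs phi ->
  local_max_on A f0 xs ->
  (forall g, closed_feasible_dirs xs A g ->
     exists2 ag : R, 0 < ag &
       forall l, convex_on_co ag (fun a : R => phi l (a *:r g))) ->
  (forall (eps : R) g, 0 < eps -> feasible_dirs xs A g ->
     exists l, dir_derivable (phi l) 0%R g /\
               (dir_deriv (phi l) 0%R g <= eps%:E)%E) /\
  (finite_set [set: Lambda] ->
     (forall g, feasible_dirs xs A g ->
        exists l, dir_derivable (phi l) 0%R g /\
                  (dir_deriv (phi l) 0%R g <= 0)%E) /\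
     ((forall l, {within closed_feasible_dirs xs A,
                    continuous (dir_deriv (phi l) 0%R)}) ->
      forall g, closed_feasible_dirs xs A g ->
        exists l, dir_derivable (phi l) 0%R g /\
                  (dir_deriv (phi l) 0%R g <= 0)%E)).
Proof.
move=> _ cA _ _ Axs ephi fmax cphi.
have dirG g : feasible_dirs xs A g -> closed_feasible_dirs xs A g.
  by move=> ?; exact: subset_closure.
have der g l : closed_feasible_dirs xs A g -> dir_derivable (phi l) 0%R g.
  move=> /cphi[b b0 cb].
  exact: (dir_derivable0 b0 (exhaustive_fin_num0 ephi l) (cb l)).
have le_eps (eps : R) g : 0 < eps -> feasible_dirs xs A g ->
    exists l, (dir_deriv (phi l) 0%R g <= eps%:E)%E.
  move=> e0 xg; have [b b0 cb] := cphi g (dirG g xg).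
  exact: (dir_deriv_le_eps cA Axs ephi fmax e0 b0 cb xg).
split=> [eps g e0 xg|finL].
  by have [l ?] := le_eps eps g e0 xg; exists l; split => //; exact/der/dirG.
have le0 g : feasible_dirs xs A g -> exists l, (dir_deriv (phi l) 0%R g <= 0)%E.
  move=> xg; apply: contrapT => /forallNP gt0.
  (* A positive derivative, possibly +oo, exceeds all small [eps]; finiteness of [Lambda] then
     yields one [eps] for all [l], against [le_eps]. *)
  have gt_eps l : \forall eps \near (0 : R)^'+,
      (eps%:E < dir_deriv (phi l) 0%R g)%E.
    have /negP := gt0 l; rewrite -ltNge.
    case: (dir_deriv (phi l) 0%R g) => [r r0|_|//]; last first.
      by near=> e; exact: ltry.
    by near=> e; rewrite lte_fin; near: e; exact: nbhs_right_lt.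
  have gt_eps_all := near_finite _ finL gt_eps.
  near (0 : R)^'+ => eps.
  have e0 : 0 < eps by near: eps; exact: nbhs_right_gt.
  have lt_eps l : (eps%:E < dir_deriv (phi l) 0%R g)%E.
    by move: l; near: eps; exact: gt_eps_all.
  by have [l] := le_eps eps g e0 xg; rewrite leNgt lt_eps.
split=> [g xg|cD g xg].
  by have [l ?] := le0 g xg; exists l; split => //; exact/der/dirG.
suff [l ?] : exists l, (dir_deriv (phi l) 0%R g <= 0)%E.
  by exists l; split => //; exact: der.
apply: contrapT => /forallNP gt0.
(* Positivity is an open condition, so relative continuity spreads it from [g] to nearby directions
   of the closure. *)
have gt0_near l : \forall h \near within (closed_feasible_dirs xs A) (nbhs g),
    (0 < dir_deriv (phi l) 0%R h)%E.
  have /subspace_continuousP/(_ g xg) := cD l.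
  move=> /(_ [set y | (0 < y)%E]); apply; apply: open_ereal_gt'.
  by rewrite ltNge; apply/negP/gt0.
(* As [g] lies in the closure, the neighbourhood common to all [l] contains a feasible direction
   [h], where [le0] is contradicted. *)
have [h [xh gt0_all]] := xg _ (near_finite _ finL gt0_near).
have [l] := le0 h xh.
by rewrite leNgt (gt0_all (dirG h xh)).
Unshelve. all: end_near. Qed.
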